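(* $$\sup_{\substack{m=1,2,\ldots\\ n=2,3,\ldots\\ \mathcal{A}\in\mathbb{A}_{\mathrm{det\text{-}zr}}^n(m)}}\ \inf_{f\in\mathbb{F}_{C^1}^n(4.086,\,17/256;\,\mathcal{A})}\ \max_{k=0,\ldots,m}\ \inf_{\boldsymbol{w}\in\mathbb{S}^n}\ \sup_{\boldsymbol{z}\in\operatorname{conv}\left(\bigcup_{\boldsymbol{y}\in\boldsymbol{x}_k+\frac18\mathbb{B}^n}\partial_{\mathrm{C}}^2 f(\boldsymbol{y})(\boldsymbol{w})\right)}\langle\boldsymbol{z},\boldsymbol{w}\rangle\ \le\ -0.0092714,$$ where $\boldsymbol{x}_0,\ldots,\boldsymbol{x}_m$ are the iterates generated by $\mathcal{A}$ when applied to (the second-order oracle that corresponds to) $f$.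
   Context: **Notation.** $\|\cdot\|$ is the Euclidean norm, $\mathbb{B}^n=\{\boldsymbol{x}\in\mathbb{R}^n:\|\boldsymbol{x}\|\le1\}$, $\mathbb{S}^n=\{\boldsymbol{x}\in\mathbb{R}^n:\|\boldsymbol{x}\|=1\}$, $\operatorname{supp}(\boldsymbol{x})=\{i\in[n]:x_i\ne0\}$ with $[n]=\{1,\ldots,n\}$, $\operatorname{conv}$ is the convex hull, and $\mathbb{R}^{n\times n}_{\mathrm{sym}}$ is the space of symmetric matrices. A $C^{1,1}$-function is a differentiable function $f:\mathbb{R}^n\to\mathbb{R}$ with Lipschitz continuous gradient. **Clarke generalized Hessian.** For a $C^{1,1}$-function $f:\mathbb{R}^n\to\mathbb{R}$ and $\boldsymbol{x}\in\mathbb{R}^n$, $\partial_{\mathrm{C}}^2 f(\boldsymbol{x})\subseteq\mathbb{R}^{n\times n}_{\mathrm{sym}}$ is the convex hull of the set of all limits $\lim_j\nabla^2 f(\boldsymbol{y}_j)$ along sequences $\boldsymbol{y}_j\to\boldsymbol{x}$ of points at which $f$ is twice differentiable. For $\boldsymbol{w}\in\mathbb{R}^n$, $\partial_{\mathrm{C}}^2 f(\boldsymbol{x})(\boldsymbol{w}):=\{\boldsymbol{A}\boldsymbol{w}:\boldsymbol{A}\in\partial_{\mathrm{C}}^2 f(\boldsymbol{x})\}$. **Deterministic second-order algorithms.** $\mathbb{A}_{\mathrm{det}}^n(m)$ is the set of all tuples $\mathcal{A}=(\boldsymbol{x}_0,\boldsymbol{A}_0,\ldots,\boldsymbol{A}_{m-1})$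 with $\boldsymbol{x}_0\in\mathbb{R}^n$ and arbitrary (deterministic) maps $\boldsymbol{A}_k:(\mathbb{R}^n\times\mathbb{R}\times\mathbb{R}^n\times\mathbb{R}^{n\times n}_{\mathrm{sym}})^{k+1}\to\mathbb{R}^n$. The second-order oracle of $f$ returns $\mathcal{O}(\boldsymbol{x})=(f(\boldsymbol{x}),\nabla f(\boldsymbol{x}),\nabla^2f(\boldsymbol{x}))$ at points near which $f$ is $C^2$. The iterates generated by $\mathcal{A}$ when applied to $f$ are $\boldsymbol{x}_0$ and, recursively, $\boldsymbol{x}_{k+1}=\boldsymbol{A}_k(\boldsymbol{x}_0,\mathcal{O}(\boldsymbol{x}_0),\ldots,\boldsymbol{x}_k,\mathcal{O}(\boldsymbol{x}_k))$ for $k=0,\ldots,m-1$ (this requires $f$ to be $C^2$ near $\boldsymbol{x}_0,\ldots,\boldsymbol{x}_{m-1}$). **Zero-respecting algorithms.** $\mathbb{A}_{\mathrm{det\text{-}zr}}^n(m)$ is the set of those $\mathcal{A}\in\mathbb{A}_{\mathrm{det}}^n(m)$ such that for every $f:\mathbb{R}^n\to\mathbb{R}$ that is $C^2$ near the iterates $\boldsymbol{x}_0,\ldots,\boldsymbol{x}_{m-1}$ generated by $\mathcal{A}$ when applied to $f$, it holds for all $k=0,\ldots,m$ that $$\operatorname{supp}(\boldsymbol{x}_k)\subseteq\Big(\bigcup_{0\le\ell<k}\operatorname{supp}(\nabla f(\boldsymbol{x}_\ell))\Big)\cup\Big(\bigcup_{0\le\ell<k}\{i\in[n]:(\nabla^2f(\boldsymbol{x}_\ell))_i\ne\boldsymbol{0}\}\Big),$$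 where $(\cdot)_i$ denotes the $i$-th row of the matrix. (In particular $\boldsymbol{x}_0=\boldsymbol{0}$.) **Function class.** For $\mathcal{A}=(\boldsymbol{x}_0,\boldsymbol{A}_0,\ldots,\boldsymbol{A}_{m-1})\in\mathbb{A}_{\mathrm{det}}^n(m)$, $\mathbb{F}_{C^1}^n(L,G;\mathcal{A})$ is the set of functions $f:\mathbb{R}^n\to\mathbb{R}$ such that: $f$ is $C^1$ and $\nabla f$ is $L$-Lipschitz continuous; $f(\boldsymbol{x}_0)-\inf_{\boldsymbol{x}\in\mathbb{R}^n}f(\boldsymbol{x})\le G$; and $f$ is $C^2$ around the iterates $\boldsymbol{x}_0,\ldots,\boldsymbol{x}_m$ generated by $\mathcal{A}$ when applied to $f$. *)

(* Defs.v *)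
From HB Require Import structures.
From mathcomp Require Import all_boot all_order all_algebra.
From mathcomp Require Import all_classical all_reals all_analysis.
Import Order.TTheory GRing.Theory Num.Theory.
Import numFieldNormedType.Exports.

Set Implicit Arguments.
Unset Strict Implicit.
Unset Printing Implicit Defensive.

Local Open Scope classical_set_scope.
Local Open Scope ring_scope.

Definition dot (R : realType) (n : nat) (u v : 'cV[R]_n) : R :=
  \sum_(i < n) u i 0 * v i 0.

(* The library norm `|x| on 'cV[R]_n is the sup norm; it induces the same
   topology and the same notion of differentiability as the Euclidean norm,
   but is not used where lengths matter. *)
Definition l2norm (R : realType) (n : nat) (x : 'cV[R]_n) : R :=
  Num.sqrt (dot x x).

Definition unit_sphere (R : realType) (n : nat) : set 'cV[R]_n :=
  [set w | l2norm w = 1].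

Definition eball (R : realType) (n : nat) (x : 'cV[R]_n) (r : R) :
    set 'cV[R]_n :=
  [set y | l2norm (y - x) <= r].

Definition convex_hull (R : realType) (E : lmodType R) (S : set E) : set E :=
  smallest (fun M : set E => convex_set M) S.

Section Calculus.
Context {R : realType} {n : nat}.
Implicit Types (f : 'cV[R]_n -> R) (x y : 'cV[R]_n).

(* grad and hess are total; they are the gradient and the Hessian wherever f
   is differentiable, resp. twice differentiable. *)
Definition grad f x : 'cV[R]_n := \col_i 'D_(delta_mx i 0) f x.

Definition hess f x : 'M[R]_n :=
  \matrix_(i, j) ('D_(delta_mx j 0) (grad f) x : 'cV[R]_n) i 0.

Definition twice_differentiable f x : Prop :=
  (\forall y \near x, differentiable f y) /\ differentiable (grad f) x.

Definition C1 f : Prop :=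
  (forall x, differentiable f x) /\ continuous (grad f).

Definition C2_near f x : Prop :=
  \forall y \near x,
    twice_differentiable f y /\ {for y, continuous (hess f)}.

Definition grad_lipschitz (L : R) f : Prop :=
  forall x y, l2norm (grad f x - grad f y) <= L * l2norm (x - y).

Definition clarke_hessian f x : set 'M[R]_n :=
  convex_hull [set A : 'M[R]_n | exists y : nat -> 'cV[R]_n,
    [/\ forall j, twice_differentiable f (y j),
        y @ \oo --> x
      & (fun j => hess f (y j)) @ \oo --> A]].

Definition clarke_hessian_vec f x (w : 'cV[R]_n) : set 'cV[R]_n :=
  [set A *m w | A in clarke_hessian f x].

End Calculus.

Section Algorithms.
Context {R : realType}.

Definition symmx (n : nat) : Type := {M : 'M[R]_n | M^T == M}.

Lemma trmx0_eq (n : nat) : (0 : 'M[R]_n)^T == 0.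
Proof. by rewrite trmx0. Qed.

Definition symmx0 (n : nat) : symmx n :=
  exist (fun M : 'M[R]_n => M^T == M) 0 (trmx0_eq n).

(* insubd returns hess f x itself as soon as this matrix is symmetric, which is
   the case at every point near which f is C^2; the default value 0 only serves
   to make the oracle total. *)
Definition oracle (n : nat) (f : 'cV[R]_n -> R) (x : 'cV[R]_n) :
    R * 'cV[R]_n * symmx n :=
  (f x, grad f x, insubd (symmx0 n) (hess f x)).

Definition info (n : nat) : Type :=
  ('cV[R]_n * (R * 'cV[R]_n * symmx n))%type.

Record algorithm (n m : nat) := Algorithm {
  start : 'cV[R]_n;
  step : forall k : 'I_m, k.+1.-tuple (info n) -> 'cV[R]_n }.

(* trajectory A f k lists x_0, ..., x_k. The value 0 appended when k >= m is
   irrelevant: only the iterates x_0, ..., x_m are ever used. *)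
Fixpoint trajectory (n m : nat) (A : algorithm n m) (f : 'cV[R]_n -> R)
    (k : nat) : k.+1.-tuple 'cV[R]_n :=
  match k with
  | 0 => [tuple start A]
  | k'.+1 =>
      let h := trajectory A f k' in
      let next := match idP : reflect _ (k' < m)%N with
        | ReflectT lt_k'm =>
            @step n m A (Ordinal lt_k'm)
              (map_tuple (fun x => (x, oracle f x)) h)
        | ReflectF _ => 0
        end in
      rcons_tuple h next
  end.

Definition iterate (n m : nat) (A : algorithm n m) (f : 'cV[R]_n -> R)
    (k : nat) : 'cV[R]_n :=
  tnth (trajectory A f k) ord_max.

Definition supp (n : nat) (x : 'cV[R]_n) : {set 'I_n} :=
  [set i | x i 0 != 0]%SET.

Definition nonzero_rows (n : nat) (M : 'M[R]_n) : {set 'I_n} :=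
  [set i | row i M != 0]%SET.

Definition zero_respecting (n m : nat) (A : algorithm n m) : Prop :=
  forall f : 'cV[R]_n -> R,
    (forall k : nat, (k < m)%N -> C2_near f (iterate A f k)) ->
    forall k : nat, (k <= m)%N ->
      supp (iterate A f k) \subset
        ((\bigcup_(l < k) supp (grad f (iterate A f l))) :|:
         (\bigcup_(l < k) nonzero_rows (hess f (iterate A f l))))%SET.

(* The subtraction is in \bar R, so a function unbounded below has gap +oo. *)
Definition function_class (n m : nat) (L G : R) (A : algorithm n m) :
    set ('cV[R]_n -> R) :=
  [set f | [/\ C1 f,
      grad_lipschitz L f,
      ((f (iterate A f 0))%:E
         - ereal_inf [set (f x)%:E | x in setT] <= G%:E)%E
    & forall k : nat, (k <= m)%N -> C2_near f (iterate A f k)]].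

End Algorithms.

Definition curvature (R : realType) (n : nat) (delta : R)
    (f : 'cV[R]_n -> R) (x : 'cV[R]_n) : \bar R :=
  ereal_inf [set ereal_sup [set (dot z w)%:E |
      z in convex_hull (\bigcup_(y in eball x delta) clarke_hessian_vec f y w)]
    | w in @unit_sphere R n].

(* Main.v *)
Require Import Defs.
From mathcomp Require Import all_boot all_order all_algebra.
From mathcomp Require Import all_classical all_reals all_analysis.
From mathcomp Require Import ring lra.
Import Order.TTheory GRing.Theory Num.Theory.
Import numFieldNormedType.Exports.

Set Implicit Arguments.
Unset Strict Implicit.
Unset Printing Implicit Defensive.

Local Open Scope classical_set_scope.
Local Open Scope ring_scope.

(** If every query is answered by value 0, gradient 0 and Hessian
    - e_i e_i^T / 2, a zero-respecting algorithm never leaves the i-th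
    coordinate axis, because i is the only nonzero row it is ever shown
    (blind_trajectory_on_axis).  Such answers do not depend on the query, so
    the m + 1 iterates are known before the objective function is chosen.  It
    remains to find a function f in the class that gives these answers at
    finitely many prescribed points of the axis and is concave, in some
    direction w, on the ball of radius 1/8 around each of them.

    Let t and s be the coordinates i and j, with j different from i.  Far from
    the iterates, f is the wave (cos (4 s) - 1) / 32.  Its only nonzero second
    derivative, - cos (4 s) / 2 in the direction e_j, is negative for
    |s| <= 1/8, but would reveal the index j to the algorithm.  So at each
    iterate the saddle (s^2 - t^2) / 4 is added, which cancels the second
    derivative in s and creates one in t.  A saddle everywhere would make f
    unbounded below along the axis, hence it is multiplied by a cutoff with
    values p^3 in [0, 1] supported in a small disc; these discs are disjoint.
    If the derivatives of the cutoff are neglected, the Hessian is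
    diag (- p^3 / 2, (p^3 - cos (4 s)) / 2), and its quadratic form at
    w = (e_i + e_j) / sqrt 2 is - cos (4 s) / 4 whatever p is: the saddle does
    not contribute in the diagonal direction.

    The derivatives of the cutoff are negligible when it varies slowly on a
    logarithmic scale.  Here p is the positive part of
    1 - delta ln (1 + r^2 / kappa): the first and second derivatives of the
    logarithm are of order 1 / r and 1 / r^2, which the quadratic saddle
    compensates, so that all error terms are O(delta) (bump11_bound,
    bump12_bound, bump22_bound), while the radius of the support is made as
    small as desired by the choice of kappa.

    All this gives a C^2 function whose gradient is 4-Lipschitz, whose values
    are at least - 1/16 - 1/256 = - 17/256, and whose quadratic form at w is at
    most - 1/10 for |s| <= 1/8 (hard_curved).  Since its Hessian is continuous,
    the Clarke Hessian at y lies in every half-space of matrices that contains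
    the Hessian at y, and the bound passes to the convex hulls
    (curvature_le). *)

(** * Functions of two coordinates: first-order calculus *)

Section PlanarCalculus.
Context {R : realType} {n : nat} (i j : 'I_n).
Implicit Types (f g : 'cV[R]_n -> R) (x v : 'cV[R]_n).

(** Differentiability and the dependence on the coordinates i and j alone are
    packed together, so that sums, products and compositions preserve both. *)
Definition planar_grad f f1 f2 : Prop :=
  forall x, is_diff x f (fun v => f1 x * v i 0 + f2 x * v j 0).

Lemma planar_grad_eq f f1 f2 g g1 g2 :
  planar_grad f f1 f2 -> f =1 g -> f1 =1 g1 -> f2 =1 g2 -> planar_grad g g1 g2.
Proof. by move=> + /funext <- /funext <- /funext <-. Qed.

Lemma planar_grad_cst (c : R) : planar_grad (fun=> c) (fun=> 0) (fun=> 0).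
Proof.
move=> x; apply: (@is_diff_eq _ _ _ (cst c)).
by apply/funext => v /=; rewrite !mul0r addr0.
Qed.

Lemma is_diff_coord (k : 'I_n) x :
  is_diff x (fun y : 'cV[R]_n => y k 0) (fun v => v k 0).
Proof.
have @c : {linear 'cV[R]_n -> R}.
  by exists (fun N : 'cV[R]_n => N k 0); do 2![eexists]; do ?[constructor];
     rewrite ?mxE// => ? *; rewrite ?mxE//; move=> ?; rewrite !mxE.
have cc : continuous c by exact: coord_continuous.
rewrite (_ : (fun _ => _) = c) //; apply: DiffDef.
  exact/linear_differentiable.
by rewrite diff_lin.
Qed.

Lemma planar_grad_fst : planar_grad (fun x => x i 0) (fun=> 1) (fun=> 0).
Proof.
move=> x; apply: (is_diff_eq (is_diff_coord i x)).
by apply/funext => v /=; rewrite mul1r mul0r addr0.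
Qed.

Lemma planar_grad_snd : planar_grad (fun x => x j 0) (fun=> 0) (fun=> 1).
Proof.
move=> x; apply: (is_diff_eq (is_diff_coord j x)).
by apply/funext => v /=; rewrite mul1r mul0r add0r.
Qed.

Lemma planar_gradD f f1 f2 g g1 g2 :
  planar_grad f f1 f2 -> planar_grad g g1 g2 ->
  planar_grad (fun x => f x + g x) (fun x => f1 x + g1 x)
    (fun x => f2 x + g2 x).
Proof.
move=> df dg x; have dfx := df x; have dgx := dg x.
apply: (is_diff_eq (is_diffD dfx dgx)).
suff E (a b c d p q : R) : a * p + b * q + (c * p + d * q) =
    (a + c) * p + (b + d) * q by apply/funext => v; exact: E.
by ring.
Qed.

Lemma planar_gradM f f1 f2 g g1 g2 :
  planar_grad f f1 f2 -> planar_grad g g1 g2 ->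
  planar_grad (fun x => f x * g x) (fun x => f1 x * g x + f x * g1 x)
    (fun x => f2 x * g x + f x * g2 x).
Proof.
move=> df dg x; have dfx := df x; have dgx := dg x.
apply: (is_diff_eq (is_diffM dfx dgx)).
suff E (k l a b c d p q : R) : k * (a * p + b * q) + l * (c * p + d * q) =
    (c * l + k * a) * p + (d * l + k * b) * q by apply/funext => v; exact: E.
by ring.
Qed.

Lemma planar_grad_comp f f1 f2 (h h' : R -> R) :
  planar_grad f f1 f2 -> (forall x, is_derive (f x) 1 h (h' (f x))) ->
  planar_grad (fun x => h (f x)) (fun x => h' (f x) * f1 x)
    (fun x => h' (f x) * f2 x).
Proof.
move=> df dh x; have dfx := df x; have [dhx hx] := dh x.
have dhx' : differentiable h (f x) by apply/derivable1_diffP.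
have H : is_diff (f x) h ( *:%R^~ (h' (f x))).
  by apply: DiffDef => //; rewrite deriv1E// derive1E hx.
apply: (is_diff_eq (is_diff_comp dfx H)).
suff E (k a b p q : R) : (a * p + b * q) * k = k * a * p + k * b * q.
  by apply/funext => v; exact: E.
by ring.
Qed.

Lemma planar_grad_sum (I : Type) (s : seq I) (F F1 F2 : I -> 'cV[R]_n -> R) :
  (forall k, planar_grad (F k) (F1 k) (F2 k)) ->
  planar_grad (fun x => \sum_(k <- s) F k x) (fun x => \sum_(k <- s) F1 k x)
    (fun x => \sum_(k <- s) F2 k x).
Proof.
move=> dF; elim: s => [|k s IHs].
  by apply: planar_grad_eq (planar_grad_cst 0) _ _ _ => x; rewrite big_nil.
by apply: planar_grad_eq (planar_gradD (dF k) IHs) _ _ _ => x; rewrite big_cons.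
Qed.

Lemma planar_grad_continuous f f1 f2 : planar_grad f f1 f2 -> continuous f.
Proof. by move=> df x; have [/differentiable_continuous] := df x. Qed.

Lemma planar_derive f f1 f2 x v : planar_grad f f1 f2 ->
  'D_v f x = f1 x * v i 0 + f2 x * v j 0.
Proof. by move=> df; have [dfx dfE] := df x; rewrite deriveE// dfE. Qed.

(** The mean value theorem along the segment from y to x. *)
Lemma planar_lipschitz f f1 f2 (M : R) : planar_grad f f1 f2 ->
  (forall x, `|f1 x| <= M) -> (forall x, `|f2 x| <= M) ->
  forall x y, `|f x - f y| <= M * (`|(x - y) i 0| + `|(x - y) j 0|).
Proof.
move=> df M1 M2 x y; pose v := x - y.
pose g (h : R) := f (y + h *: v).
have dg (h : R) : is_derive h 1 g
    (f1 (y + h *: v) * v i 0 + f2 (y + h *: v) * v j 0).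
  have dl : is_diff h (fun h : R => y + h *: v) ( *:%R^~ v).
    apply: (is_diff_eq (is_diffD (is_diff_cst y h) (is_diff_scalel h v))).
    by apply/funext => k; rewrite fctE add0r.
  have dfx := df (y + h *: v).
  have [dgh gE] := is_diff_comp dl dfx.
  have dgh' : derivable g h 1 by apply/derivable1_diffP.
  apply: DeriveDef => //.
  by rewrite deriveE// gE /= !mxE mul1r; congr (_ * _ + _ * _); rewrite mul1r.
have [|c _ gE] := @MVT R g _ 0 1 ltr01 (fun h _ => dg h).
  apply: continuous_subspaceT => h.
  by have [/derivable1_diffP/differentiable_continuous] := dg h.
have -> : f x - f y = g 1 - g 0.
  by rewrite /g scale1r scale0r addr0 /v addrCA subrr addr0.
rewrite gE subr0 mulr1 (le_trans (ler_normD _ _))// !normrM mulrDr.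
by rewrite lerD// ler_wpM2r.
Qed.

End PlanarCalculus.

(** * Functions of two coordinates: Hessian and Lipschitz gradient *)

Section PlanarC2.
Context {R : realType} {n : nat} (i j : 'I_n) (neq_ij : i != j).
Context (f f1 f2 f11 f12 f22 : 'cV[R]_n -> R).
Hypotheses (df : planar_grad i j f f1 f2) (df1 : planar_grad i j f1 f11 f12)
  (df2 : planar_grad i j f2 f12 f22).

Lemma planar_gradE x :
  grad f x = f1 x *: delta_mx i 0 + f2 x *: delta_mx j 0.
Proof.
apply/colP => k; rewrite !mxE (planar_derive _ _ df) !mxE !eqxx !andbT.
by rewrite ![_ == k]eq_sym.
Qed.

Lemma planar_grad_differentiable x : differentiable (grad f) x.
Proof.
rewrite (funext planar_gradE).
have [? _] := df1 x; have [? _] := df2 x.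
by apply: differentiableD; apply: differentiableZl.
Qed.

Lemma planar_hessE x :
  hess f x = f11 x *: delta_mx i i + f12 x *: (delta_mx i j + delta_mx j i)
    + f22 x *: delta_mx j j.
Proof.
have [d1 _] := df1 x; have [d2 _] := df2 x.
apply/matrixP => k l; rewrite !mxE derive_mx; last first.
  exact/diff_derivable/planar_grad_differentiable.
rewrite mxE.
under eq_fun do rewrite planar_gradE !mxE !eqxx !andbT.
rewrite (@planar_derive _ _ i j _
  (fun y => f11 y * (k == i)%:R + f12 y * (k == j)%:R)
  (fun y => f12 y * (k == i)%:R + f22 y * (k == j)%:R)); last first.
  have H a := planar_grad_cst i j (a : R).
  by apply: (planar_grad_eq (planar_gradD (planar_gradM df1 (H (k == i)%:R))
    (planar_gradM df2 (H (k == j)%:R)))) => y //=;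
    rewrite !mulr0 !addr0.
rewrite !mxE !eqxx !andbT ![l == _]eq_sym.
by do ![case: (_ == _)] => /=; ring.
Qed.

Lemma planar_twice_differentiable x : twice_differentiable f x.
Proof.
split; last exact: planar_grad_differentiable.
by near=> y; have [] := df y.
Unshelve. all: by end_near. Qed.

Lemma planar_C1 : C1 f.
Proof.
split=> [x|x]; first by have [] := df x.
exact/differentiable_continuous/planar_grad_differentiable.
Qed.

Hypotheses (c11 : continuous f11) (c12 : continuous f12)
  (c22 : continuous f22).

Lemma planar_hess_continuous : continuous (hess f).
Proof.
rewrite (funext planar_hessE) => x.
have F : Filter (nbhs x) by exact: (@nbhs_filter 'cV[R]_n x).
have h11 := cvgZr_tmp (a := delta_mx i i : 'M[R]_n) (@c11 x).
have h12 := cvgZr_tmp (a := delta_mx i j + delta_mx j i : 'M[R]_n) (@c12 x).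
have h22 := cvgZr_tmp (a := delta_mx j j : 'M[R]_n) (@c22 x).
exact: (cvgD (cvgD (h11 F) (h12 F)) (h22 F)).
Qed.

Lemma planar_C2_near x : C2_near f x.
Proof.
near=> y; split; first exact: planar_twice_differentiable.
exact: planar_hess_continuous.
Unshelve. all: by end_near. Qed.

Lemma dot_ge_pair (v : 'cV[R]_n) : v i 0 ^+ 2 + v j 0 ^+ 2 <= dot v v.
Proof.
rewrite /dot (bigD1 i)//= (bigD1 j) 1?eq_sym//= addrA -!expr2 lerDl.
by apply: sumr_ge0 => k _; rewrite -expr2 sqr_ge0.
Qed.

(** Each of the two gradient components is M-Lipschitz for the l1 norm of the
    pair of coordinates, and passing to the Euclidean norm costs a factor
    sqrt 2 on each side. *)
Lemma planar_grad_lipschitz (M : R) :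
  (forall x, `|f11 x| <= M) -> (forall x, `|f12 x| <= M) ->
  (forall x, `|f22 x| <= M) -> grad_lipschitz (2 * M) f.
Proof.
move=> M11 M12 M22 x y.
have M0 : 0 <= M by apply: le_trans (M11 0).
set v := x - y.
have l1 := planar_lipschitz df1 M11 M12 x y.
have l2 := planar_lipschitz df2 M12 M22 x y.
set a := f1 x - f1 y in l1; set b := f2 x - f2 y in l2.
have gE : dot (grad f x - grad f y) (grad f x - grad f y) = a ^+ 2 + b ^+ 2.
  rewrite /dot (bigD1 i)//= (bigD1 j) 1?eq_sym//= big1 ?addr0; last first.
    move=> k /andP[/negPf ki /negPf kj].
    by rewrite !planar_gradE !mxE ki kj /= !mulr0 !addr0 subrr mulr0.
  rewrite !planar_gradE !mxE !eqxx (negPf neq_ij) eq_sym (negPf neq_ij) /=.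
  by rewrite /a /b; ring.
rewrite /l2norm gE -[2 * M]ger0_norm ?mulr_ge0// -sqrtr_sqr -sqrtrM ?sqr_ge0//.
apply: ler_wsqrtr.
apply: (@le_trans _ _ ((2 * M) ^+ 2 * (v i 0 ^+ 2 + v j 0 ^+ 2))); last first.
  by rewrite ler_wpM2l ?sqr_ge0// dot_ge_pair.
move: l1 l2; rewrite -/v => l1 l2.
have a2 : a ^+ 2 <= (M * (`|v i 0| + `|v j 0|)) ^+ 2.
  by rewrite -(real_normK (num_real a)) lerXn2r// ?nnegrE// mulr_ge0// addr_ge0.
have b2 : b ^+ 2 <= (M * (`|v i 0| + `|v j 0|)) ^+ 2.
  by rewrite -(real_normK (num_real b)) lerXn2r// ?nnegrE// mulr_ge0// addr_ge0.
rewrite -(real_normK (num_real (v i 0))) -(real_normK (num_real (v j 0))).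
set p := `|v i 0| in a2 b2 *; set q := `|v j 0| in a2 b2 *.
(* (p + q)^2 <= 2 (p^2 + q^2) *)
have : 0 <= M ^+ 2 * (p - q) ^+ 2 by rewrite mulr_ge0// sqr_ge0.
rewrite !exprMn in a2 b2 *; lra.
Qed.

Lemma planar_dot_hess (c : R) x :
  let w := c *: (delta_mx i 0 + delta_mx j 0) in
  dot (hess f x *m w) w = c ^+ 2 * (f11 x + 2 * f12 x + f22 x).
Proof.
set w := c *: _ => /=.
have wi : w i 0 = c by rewrite !mxE !eqxx (negPf neq_ij) addr0 mulr1.
have wj : w j 0 = c by rewrite !mxE !eqxx eq_sym (negPf neq_ij) add0r mulr1.
have wk k : k != i -> k != j -> w k 0 = 0.
  by move=> /negPf ki /negPf kj; rewrite !mxE ki kj addr0 mulr0.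
have sumE (g : 'I_n -> R) : \sum_k g k * w k 0 = (g i + g j) * c.
  rewrite (bigD1 i)//= (bigD1 j) 1?eq_sym//= big1 ?addr0.
    by rewrite wi wj mulrDl.
  by move=> k /andP[ki kj]; rewrite wk ?mulr0.
rewrite /dot sumE !mxE !sumE planar_hessE !mxE !eqxx.
by rewrite (negPf neq_ij) eq_sym (negPf neq_ij) /=; ring.
Qed.

End PlanarC2.

(** * Powers of the positive part *)

Section PositivePart.
Context {R : realType}.
Implicit Types y : R.

Definition pospart y : R := Num.max y 0.

Lemma pospart_ge0 y : 0 <= pospart y.
Proof. by rewrite /pospart le_max lexx orbT. Qed.

Lemma pospart_id y : 0 <= y -> pospart y = y.
Proof. by move=> y0; rewrite /pospart; apply/max_idPl. Qed.

Lemma pospart_eq0 y : y <= 0 -> pospart y = 0.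
Proof. by move=> y0; rewrite /pospart; apply/max_idPr. Qed.

Lemma pospart_continuous : continuous pospart.
Proof.
move=> y; apply: (@continuous_max R R id (cst 0)) => //; exact: cvg_cst.
Qed.

(** At 0 the absolute value of the difference quotient is at most |h|^(k+1). *)
Lemma is_derive_pospartX (k : nat) y :
  is_derive y 1 (fun z => pospart z ^+ k.+2) (k.+2%:R * pospart y ^+ k.+1).
Proof.
have [y0|y0|->] := ltgtP y 0.
- rewrite pospart_eq0 ?ltW// expr0n mulr0.
  apply: (@near_eq_is_derive _ _ _ (cst 0)) => //.
  near=> z; rewrite /= pospart_eq0 ?expr0n//.
  by apply/ltW; near: z; exact: lt_nbhsl.
- rewrite pospart_id ?ltW//.
  have H : is_derive y 1 (fun z : R => z ^+ k.+2) (k.+2%:R * y ^+ k.+1).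
    apply: DeriveDef; first exact: exprn_derivable.
    by rewrite exp_derive /GRing.scale /= mulr1 mulr_natl.
  apply: (near_eq_is_derive _ H).
  near=> z; rewrite pospart_id//.
  by apply/ltW; near: z; exact: lt_nbhsr.
rewrite pospart_eq0// expr0n mulr0.
suff H : (fun h : R => h^-1 *:
    (((fun z => pospart z ^+ k.+2) \o shift 0) (h *: 1) - pospart 0 ^+ k.+2)) @ 0^' --> (0 : R).
  by apply: DeriveDef; [apply/cvg_ex; exists 0|exact: cvg_lim H].
apply/cvgrPdist_le => e e0; near=> h.
rewrite /= addr0 (pospart_eq0 (lexx 0)) expr0n /= subr0 sub0r normrN.
have h0 : h != 0 by near: h; exact: nbhs_dnbhs_neq.
have h1 : `|h| <= 1 by near: h; exact: dnbhs0_le.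
have he : `|h| <= e by near: h; exact: dnbhs0_le.
rewrite /GRing.scale /= mulr1.
have ph : `|pospart h| <= `|h|.
  rewrite ger0_norm ?pospart_ge0// /pospart ge_max normr_ge0 andbT.
  exact: ler_norm.
rewrite normrM normfV ler_pdivrMl ?normr_gt0// normrX exprS.
rewrite ler_pM// exprS (le_trans _ he)// (le_trans _ ph)//.
by rewrite ler_piMr// exprn_ile1// (le_trans ph).
Unshelve. all: by end_near. Qed.

End PositivePart.

(** * The slowly cut off saddle *)

Section Bump.
Context {R : realType} (delta kappa : R).
Implicit Types t s : R.

(** The squared radius, shifted by kappa to stay away from the singularity of
    the logarithm. *)
Definition bump_den t s := kappa + t ^+ 2 + s ^+ 2.

Definition bump_level t s := 1 - delta * (ln (bump_den t s) - ln kappa).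

Definition bump_pos t s := pospart (bump_level t s).

Definition saddle t s := (s ^+ 2 - t ^+ 2) / 4.

(** The cube is the lowest power of the positive part that is C^2. *)
Definition bump t s := bump_pos t s ^+ 3 * saddle t s.

(** bump1, bump2 and bump11, bump12, bump22 are the partial derivatives of bump
    of order one and two. *)
Definition bump1 t s :=
  - (6 * delta * bump_pos t s ^+ 2 * (t * (bump_den t s)^-1) * saddle t s)
  - bump_pos t s ^+ 3 * t / 2.

Definition bump2 t s :=
  - (6 * delta * bump_pos t s ^+ 2 * (s * (bump_den t s)^-1) * saddle t s)
  + bump_pos t s ^+ 3 * s / 2.

Definition bump11 t s :=
  let p := bump_pos t s in let e := (bump_den t s)^-1 in let u := t * e in
  (24 * delta ^+ 2 * p * u ^+ 2 - 6 * delta * p ^+ 2 * (e - 2 * u ^+ 2))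
    * saddle t s + 6 * delta * p ^+ 2 * (u * t) - p ^+ 3 / 2.

Definition bump12 t s :=
  let p := bump_pos t s in let e := (bump_den t s)^-1 in
  (24 * delta ^+ 2 * p + 12 * delta * p ^+ 2) * ((t * e) * (s * e))
    * saddle t s.

Definition bump22 t s :=
  let p := bump_pos t s in let e := (bump_den t s)^-1 in let v := s * e in
  (24 * delta ^+ 2 * p * v ^+ 2 - 6 * delta * p ^+ 2 * (e - 2 * v ^+ 2))
    * saddle t s - 6 * delta * p ^+ 2 * (v * s) + p ^+ 3 / 2.

Hypothesis kappa_gt0 : 0 < kappa.

Lemma bump_den_gt0 t s : 0 < bump_den t s.
Proof. by rewrite /bump_den -addrA ltr_pwDl// addr_ge0// sqr_ge0. Qed.

Section BumpDerivatives.
Context {n : nat} (i j : 'I_n) (tau : R).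

Let T (x : 'cV[R]_n) : R := x i 0 - tau.
Let S (x : 'cV[R]_n) : R := x j 0.
Let D x := bump_den (T x) (S x).

Let D_neq0 x : D x != 0.
Proof. by rewrite gt_eqF ?bump_den_gt0. Qed.

Let dT : planar_grad i j T (fun=> 1) (fun=> 0).
Proof.
by apply: (planar_grad_eq (planar_gradD (planar_grad_fst i j)
  (planar_grad_cst i j (- tau)))) => x //; rewrite addr0.
Qed.

Let dS : planar_grad i j S (fun=> 0) (fun=> 1).
Proof. exact: planar_grad_snd. Qed.

Let dD : planar_grad i j D (fun x => 2 * T x) (fun x => 2 * S x).
Proof.
apply: (planar_grad_eq (planar_gradD (planar_gradD (planar_grad_cst i j kappa)
  (planar_gradM dT dT)) (planar_gradM dS dS))) => x; rewrite /D /bump_den; ring.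
Qed.

Let E x := (D x)^-1.

Let dE : planar_grad i j E (fun x => - 2 * (T x * E x) * E x)
  (fun x => - 2 * (S x * E x) * E x).
Proof.
have dinv x : is_derive (D x) 1 (@GRing.inv R) ((fun y => - y ^- 2) (D x)).
  have I : derivable (id : R -> R) (D x) 1 by exact: derivable_id.
  have H1 := @derivableV R R id (D x) 1 (D_neq0 x) I.
  have H2 := @deriveV R R id (D x) 1 (D_neq0 x) I.
  apply: DeriveDef => //; rewrite [LHS]H2 derive_id.
  by rewrite /GRing.scale /= mulr1.
by apply: (planar_grad_eq
    (planar_grad_comp (h' := fun y => - y ^- 2) dD dinv)) => x //;
  rewrite /E /=; field; exact: D_neq0.
Qed.

Let U x := T x * E x.
Let V x := S x * E x.

Let dU : planar_grad i j U (fun x => E x - 2 * U x ^+ 2)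
  (fun x => - 2 * U x * V x).
Proof.
by apply: (planar_grad_eq (planar_gradM dT dE)) => x //; rewrite /U /V; ring.
Qed.

Let dV : planar_grad i j V (fun x => - 2 * U x * V x)
  (fun x => E x - 2 * V x ^+ 2).
Proof.
by apply: (planar_grad_eq (planar_gradM dS dE)) => x //; rewrite /U /V; ring.
Qed.

Let N x := bump_level (T x) (S x).

Let dN : planar_grad i j N (fun x => - 2 * delta * U x)
  (fun x => - 2 * delta * V x).
Proof.
have H x : is_derive (D x) 1 (@ln R) ((fun y => y^-1) (D x)).
  exact/is_derive1_ln/bump_den_gt0.
have := planar_gradD (planar_grad_cst i j 1)
  (planar_gradM (planar_grad_cst i j (- delta))
    (planar_gradD (planar_grad_comp (h' := fun y => y^-1) dD H)
      (planar_grad_cst i j (- ln kappa)))).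
move/planar_grad_eq; apply=> x; rewrite /N /bump_level /U /V /E /D /=; ring.
Qed.

Let Q x := saddle (T x) (S x).

Let dQ : planar_grad i j Q (fun x => - T x / 2) (fun x => S x / 2).
Proof.
have := planar_gradM (planar_gradD (planar_gradM dS dS)
  (planar_gradM (planar_grad_cst i j (-1)) (planar_gradM dT dT)))
  (planar_grad_cst i j (1 / 4)).
by move/planar_grad_eq; apply=> x; rewrite /Q /saddle; field.
Qed.

Let P x := bump_pos (T x) (S x).

Let dP2 : planar_grad i j (fun x => P x ^+ 2)
  (fun x => - 4 * delta * P x * U x) (fun x => - 4 * delta * P x * V x).
Proof.
have H x := @is_derive_pospartX R 0 (N x).
have := planar_grad_comp (h' := fun y => 2%:R * pospart y ^+ 1) dN H.
by move/planar_grad_eq; apply=> x; rewrite /P /bump_pos -/(N x) /=; ring.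
Qed.

Let dP3 : planar_grad i j (fun x => P x ^+ 3)
  (fun x => - 6 * delta * P x ^+ 2 * U x)
  (fun x => - 6 * delta * P x ^+ 2 * V x).
Proof.
have H x := @is_derive_pospartX R 1 (N x).
have := planar_grad_comp (h' := fun y => 3%:R * pospart y ^+ 2) dN H.
by move/planar_grad_eq; apply=> x; rewrite /P /bump_pos -/(N x) /=; ring.
Qed.

Lemma planar_grad_bump : planar_grad i j
  (fun x : 'cV[R]_n => bump (x i 0 - tau) (x j 0))
  (fun x => bump1 (x i 0 - tau) (x j 0))
  (fun x => bump2 (x i 0 - tau) (x j 0)).
Proof.
have := planar_gradM dP3 dQ.
by move/planar_grad_eq; apply=> x //;
  rewrite /bump1 /bump2 -/(T x) -/(S x) -/(P x) -/(Q x)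
    -/(D x) -/(E x) /U /V; field.
Qed.

Lemma planar_grad_bump1 : planar_grad i j
  (fun x : 'cV[R]_n => bump1 (x i 0 - tau) (x j 0))
  (fun x => bump11 (x i 0 - tau) (x j 0))
  (fun x => bump12 (x i 0 - tau) (x j 0)).
Proof.
have c (a : R) := planar_grad_cst i j a.
have := planar_gradD
  (planar_gradM (c (- 6 * delta)) (planar_gradM dP2 (planar_gradM dU dQ)))
  (planar_gradM (c (- 1 / 2)) (planar_gradM dP3 dT)).
by move/planar_grad_eq; apply=> x;
  rewrite /bump1 /bump11 /bump12 -/(T x) -/(S x) -/(P x) -/(Q x)
    -/(D x) -/(E x) /U /V; field.
Qed.

Lemma planar_grad_bump2 : planar_grad i j
  (fun x : 'cV[R]_n => bump2 (x i 0 - tau) (x j 0))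
  (fun x => bump12 (x i 0 - tau) (x j 0))
  (fun x => bump22 (x i 0 - tau) (x j 0)).
Proof.
have c (a : R) := planar_grad_cst i j a.
have := planar_gradD
  (planar_gradM (c (- 6 * delta)) (planar_gradM dP2 (planar_gradM dV dQ)))
  (planar_gradM (c (1 / 2)) (planar_gradM dP3 dS)).
by move/planar_grad_eq; apply=> x;
  rewrite /bump2 /bump12 /bump22 -/(T x) -/(S x) -/(P x) -/(Q x)
    -/(D x) -/(E x) /U /V; field.
Qed.

Let cM (f g : 'cV[R]_n -> R) : continuous f -> continuous g ->
  continuous (fun x => f x * g x).
Proof. by move=> cf cg x; exact: (cvgM (cf x) (cg x)). Qed.

Let cD (f g : 'cV[R]_n -> R) : continuous f -> continuous g ->
  continuous (fun x => f x + g x).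
Proof. by move=> cf cg x; exact: (cvgD (cf x) (cg x)). Qed.

Let cN (f : 'cV[R]_n -> R) : continuous f -> continuous (fun x => - f x).
Proof. by move=> cf x; exact: (cvgN (cf x)). Qed.

Let cX (f : 'cV[R]_n -> R) k : continuous f -> continuous (fun x => f x ^+ k).
Proof.
move=> cf; elim: k => [|k IHk]; first exact: cst_continuous.
rewrite (_ : (fun x => _) = (fun x => f x * f x ^+ k)); first exact: cM.
by apply/funext => x; rewrite exprS.
Qed.

Let cc (a : R) : continuous (fun _ : 'cV[R]_n => a).
Proof. exact: cst_continuous. Qed.

Let cE : continuous E. Proof. exact: planar_grad_continuous dE. Qed.
Let cT : continuous T. Proof. exact: planar_grad_continuous dT. Qed.
Let cS : continuous S. Proof. exact: planar_grad_continuous dS. Qed.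
Let cQ : continuous Q. Proof. exact: planar_grad_continuous dQ. Qed.
Let cP : continuous P.
Proof.
move=> x; apply: (@continuous_comp _ _ _ N (@pospart R)).
  exact: (planar_grad_continuous dN).
exact: pospart_continuous.
Qed.

Let cU : continuous U. Proof. exact: cM. Qed.
Let cV : continuous V. Proof. exact: cM. Qed.

Lemma bump11_continuous :
  continuous (fun x : 'cV[R]_n => bump11 (x i 0 - tau) (x j 0)).
Proof.
rewrite (_ : (fun x => _) = fun x =>
  (24 * delta ^+ 2 * P x * U x ^+ 2
    + - (6 * delta * P x ^+ 2 * (E x + - (2 * U x ^+ 2)))) * Q x
  + 6 * delta * P x ^+ 2 * (U x * T x) + - (P x ^+ 3 * 2^-1)) //.
exact: (cD (cD (cM (cD (cM (cM (@cc (24 * delta ^+ 2)) cP) (@cX _ 2 cU))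
    (cN (cM (cM (@cc (6 * delta)) (@cX _ 2 cP))
      (cD cE (cN (cM (@cc 2) (@cX _ 2 cU))))))) cQ)
    (cM (cM (@cc (6 * delta)) (@cX _ 2 cP)) (cM cU cT)))
    (cN (cM (@cX _ 3 cP) (@cc 2^-1)))).
Qed.

Lemma bump12_continuous :
  continuous (fun x : 'cV[R]_n => bump12 (x i 0 - tau) (x j 0)).
Proof.
rewrite (_ : (fun x => _) = fun x =>
  (24 * delta ^+ 2 * P x + 12 * delta * P x ^+ 2) * (U x * V x) * Q x) //.
exact: (cM (cM (cD (cM (@cc (24 * delta ^+ 2)) cP)
    (cM (@cc (12 * delta)) (@cX _ 2 cP))) (cM cU cV)) cQ).
Qed.

Lemma bump22_continuous :
  continuous (fun x : 'cV[R]_n => bump22 (x i 0 - tau) (x j 0)).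
Proof.
rewrite (_ : (fun x => _) = fun x =>
  (24 * delta ^+ 2 * P x * V x ^+ 2
    + - (6 * delta * P x ^+ 2 * (E x + - (2 * V x ^+ 2)))) * Q x
  + - (6 * delta * P x ^+ 2 * (V x * S x)) + P x ^+ 3 * 2^-1) //.
exact: (cD (cD (cM (cD (cM (cM (@cc (24 * delta ^+ 2)) cP) (@cX _ 2 cV))
    (cN (cM (cM (@cc (6 * delta)) (@cX _ 2 cP))
      (cD cE (cN (cM (@cc 2) (@cX _ 2 cV))))))) cQ)
    (cN (cM (cM (@cc (6 * delta)) (@cX _ 2 cP)) (cM cV cS))))
    (cM (@cX _ 3 cP) (@cc 2^-1))).
Qed.

End BumpDerivatives.

Section BumpBounds.
Hypotheses (delta_ge0 : 0 <= delta) (delta_le : delta <= 1 / 4).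
Variables t s : R.

Let D := bump_den t s.
Let D_gt0 : 0 < D := bump_den_gt0 t s.

Lemma bump_pos_le1 : bump_pos t s <= 1.
Proof.
rewrite /bump_pos /pospart ge_max ler01 andbT gerBl mulr_ge0// subr_ge0.
by rewrite ler_ln ?posrE// /bump_den -addrA lerDl addr_ge0// sqr_ge0.
Qed.

(* All error terms are delta times a polynomial in the scale-invariant ratios
   a, b, t s / D and in the cutoff, which all have absolute value at most 1. *)
Let a := t ^+ 2 / D.
Let b := s ^+ 2 / D.

Let abP : [/\ 0 <= a, 0 <= b & a + b <= 1].
Proof.
have D0 := ltW D_gt0.
split; rewrite /a /b ?divr_ge0 ?sqr_ge0// -mulrDl ler_pdivrMr// mul1r.
by rewrite /D /bump_den -addrA lerDr ltW.
Qed.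

Let ler_normM_le (x y p q : R) : `|x| <= p -> `|y| <= q -> `|x * y| <= p * q.
Proof. by move=> xp yq; rewrite normrM ler_pM. Qed.

Let p := bump_pos t s.

Let p01 : `|p| <= 1.
Proof. by rewrite ger0_norm ?pospart_ge0// bump_pos_le1. Qed.

Let p201 : `|p ^+ 2| <= 1.
Proof. by rewrite normrX exprn_ile1. Qed.

(** The main term - p^3 / 2 is the cutoff times the second derivative of the
    saddle; whatever differentiates the logarithm is an error term. *)
Lemma bump11_bound : `|bump11 t s + bump_pos t s ^+ 3 / 2| <= 12 * delta.
Proof.
have [a0 b0 ab1] := abP.
have -> : bump11 t s + bump_pos t s ^+ 3 / 2 =
    delta * (6 * delta * (p * (a * (b - a)))
      - 6 / 4 * (p ^+ 2 * ((1 - 2 * a) * (b - a))) + 6 * (p ^+ 2 * a)).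
  rewrite /bump11 -/p -/D /saddle /a /b; field; exact: lt0r_neq0.
have h1 : `|p * (a * (b - a))| <= 1 * (1 * 1).
  by do !apply: ler_normM_le => //; rewrite ler_norml; lra.
have h2 : `|p ^+ 2 * ((1 - 2 * a) * (b - a))| <= 1 * (1 * 1).
  by do !apply: ler_normM_le => //; rewrite ler_norml; lra.
have h3 : `|p ^+ 2 * a| <= 1 * 1.
  by apply: ler_normM_le => //; rewrite ler_norml; lra.
have h4 : `|delta * (p * (a * (b - a)))| <= 1 / 4 * (1 * (1 * 1)).
  by apply: ler_normM_le => //; rewrite ger0_norm.
rewrite mulrC normrM (ger0_norm delta_ge0) ler_wpM2r// ler_norml.
by move: h2 h3 h4; rewrite !ler_norml => /andP[? ?] /andP[? ?] /andP[? ?]; lra.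
Qed.

Lemma bump12_bound : `|bump12 t s| <= 12 * delta.
Proof.
have [a0 b0 ab1] := abP.
pose c := t * s / D.
have c1 : `|c| <= 1.
  have : c ^+ 2 <= 1 ^+ 2.
    have -> : c ^+ 2 = a * b by rewrite /c /a /b; field; exact: lt0r_neq0.
    by rewrite expr1n mulr_ile1//; lra.
  by rewrite -real_normK ?num_real// ler_pXn2r ?nnegrE.
have -> : bump12 t s = delta * (6 * delta * (p * (c * (b - a)))
    + 3 * (p ^+ 2 * (c * (b - a)))).
  rewrite /bump12 -/p -/D /saddle /a /b /c; field; exact: lt0r_neq0.
have h1 : `|p * (c * (b - a))| <= 1 * (1 * 1).
  by do !apply: ler_normM_le => //; rewrite ler_norml; lra.
have h2 : `|p ^+ 2 * (c * (b - a))| <= 1 * (1 * 1).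
  by do !apply: ler_normM_le => //; rewrite ler_norml; lra.
have h4 : `|delta * (p * (c * (b - a)))| <= 1 / 4 * (1 * (1 * 1)).
  by apply: ler_normM_le => //; rewrite ger0_norm.
rewrite mulrC normrM (ger0_norm delta_ge0) ler_wpM2r// ler_norml.
by move: h2 h4; rewrite !ler_norml => /andP[? ?] /andP[? ?]; lra.
Qed.

Lemma bump_ge : - (t ^+ 2 / 4) <= bump t s.
Proof.
rewrite /bump -/p.
have p3 : `|p ^+ 3| <= 1 by rewrite normrX exprn_ile1.
have p30 : 0 <= p ^+ 3 by rewrite exprn_ge0// pospart_ge0.
have s0 : 0 <= p ^+ 3 * (s ^+ 2) by rewrite mulr_ge0// sqr_ge0.
have t0 : p ^+ 3 * (t ^+ 2) <= t ^+ 2.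
  by rewrite ler_piMl ?sqr_ge0// (le_trans (ler_norm _)).
rewrite /saddle; lra.
Qed.

End BumpBounds.

(** Exchanging the two coordinates changes the sign of the saddle. *)
Lemma bump22_bound (t s : R) : 0 <= delta -> delta <= 1 / 4 ->
  `|bump22 t s - bump_pos t s ^+ 3 / 2| <= 12 * delta.
Proof.
move=> d0 d1; have := bump11_bound d0 d1 s t; rewrite -normrN.
have denC : bump_den t s = bump_den s t by rewrite /bump_den addrAC.
have posC : bump_pos t s = bump_pos s t.
  by rewrite /bump_pos /bump_level denC.
congr (`|_| <= _); rewrite /bump11 /bump22 posC denC /saddle; field.
by rewrite gt_eqF ?bump_den_gt0.
Qed.

End Bump.

(** * Sums over separated centers *)

Section SeparatedCenters.
Context {R : realType}.

Definition separated (rho : R) (s : seq R) : Prop :=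
  uniq s /\ {in s &, forall a b, a != b -> 2 * rho <= `|a - b|}.

Lemma exists_small_gap (l : seq R) (M : R) : 0 < M ->
  exists2 rho, 0 < rho <= M & {in l, forall d, d != 0 -> 2 * rho <= `|d|}.
Proof.
move=> M0; elim: l => [|d l [rho /andP[r0 rM] IH]].
  by exists M; rewrite ?M0 ?lexx.
have [d0|d0] := eqVneq d 0.
  exists rho; rewrite ?r0// => e; rewrite in_cons => /predU1P[->|/IH//].
  by rewrite d0 eqxx.
exists (Num.min rho (`|d| / 2)).
  by rewrite lt_min r0 divr_gt0 ?normr_gt0//= ge_min rM.
move=> e; rewrite in_cons => /predU1P[-> _|el e0].
  by rewrite mulrC -ler_pdivlMr// ge_min lexx orbT.
by apply: le_trans (IH e el e0); rewrite ler_pM2l// ge_min lexx.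
Qed.

Lemma exists_separated (s : seq R) (M : R) : 0 < M -> uniq s ->
  exists2 rho, 0 < rho <= M & separated rho s.
Proof.
move=> M0 us.
have [rho rhoP H] := exists_small_gap [seq a - b | a <- s, b <- s] M0.
exists rho => //; split=> // a b sa sb ab; apply: H; last by rewrite subr_eq0.
exact: allpairs_f.
Qed.

(** The alternative depends on t only, not on the kernel K: one case analysis
    serves a function and all its derivatives. *)
Lemma sum_locally_single (rho : R) (s : seq R) (t : R) : separated rho s ->
  (forall K : R -> R, (forall d, rho <= `|d| -> K d = 0) ->
    \sum_(a <- s) K (t - a) = 0) \/
  (exists2 a, a \in s & forall K : R -> R,
    (forall d, rho <= `|d| -> K d = 0) -> \sum_(b <- s) K (t - b) = K (t - a)).
Proof.
move=> [us sep]; have [/hasP[a sa ta]|/hasPn far] :=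
  boolP (has (fun a => `|t - a| < rho) s); [right|left].
- exists a => // K K0; rewrite (bigD1_seq a)//= big_seq_cond big1 ?addr0//.
  move=> b /andP[sb ba]; apply: K0; have := sep b a sb sa ba.
  have := ler_normB (t - a) (t - b).
  by rewrite (_ : t - a - (t - b) = b - a); [lra|ring].
- move=> K K0; rewrite big_seq big1// => a /far; rewrite -leNgt; exact: K0.
Qed.

End SeparatedCenters.

(** * The resisting function of a finite set of centers *)

Lemma cos_ge1B (R : realType) (y : R) : 1 - `|y| <= cos y.
Proof.
wlog y0 : y / 0 < y => [H|].
  have [y0|y0|->] := ltgtP y 0; last by rewrite normr0 cos0 subr0.
    by rewrite -normrN -cosN; apply: H; rewrite oppr_gt0.
  exact: H.
have [|c _] :=
    @MVT R cos (fun y => - sin y) 0 y y0 (fun c _ => is_derive_cos c).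
  exact/continuous_subspaceT/continuous_cos.
have : sin c <= 1 by have := sin_max c; rewrite ler_norml => /andP[].
move=> sc; rewrite cos0 subr0 gtr0_norm// => e.
have : sin c * y <= y by rewrite ler_piMl// ltW.
by lra.
Qed.

Section HardFunction.
Context {R : realType} {n : nat} (i j : 'I_n).
Variables (rho : R) (s : seq R).

(* The four second-order error terms, 12 delta each, must leave
   - 1/4 + 48 delta <= - 1/5. *)
Let delta : R := 1 / 1000.
(* Makes the cutoff vanish at distance rho: ln (rho^2 / kappa) = 1 / delta. *)
Let kappa : R := rho ^+ 2 * expR (- delta^-1).

Definition hard (x : 'cV[R]_n) : R :=
  (cos (4 * x j 0) - 1) / 32
  + \sum_(a <- s) bump delta kappa (x i 0 - a) (x j 0).

(** hard1, hard2 and hard11, hard12, hard22 are the partial derivatives of hard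
    of order one and two. *)
Definition hard1 (x : 'cV[R]_n) : R :=
  \sum_(a <- s) bump1 delta kappa (x i 0 - a) (x j 0).

Definition hard2 (x : 'cV[R]_n) : R :=
  - sin (4 * x j 0) / 8
  + \sum_(a <- s) bump2 delta kappa (x i 0 - a) (x j 0).

Definition hard11 (x : 'cV[R]_n) : R :=
  \sum_(a <- s) bump11 delta kappa (x i 0 - a) (x j 0).

Definition hard12 (x : 'cV[R]_n) : R :=
  \sum_(a <- s) bump12 delta kappa (x i 0 - a) (x j 0).

Definition hard22 (x : 'cV[R]_n) : R :=
  - cos (4 * x j 0) / 2
  + \sum_(a <- s) bump22 delta kappa (x i 0 - a) (x j 0).

Hypotheses (rho_gt0 : 0 < rho) (rho_le : rho <= 1 / 8)
  (sep : separated rho s).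

Let kappa_gt0 : 0 < kappa.
Proof. by rewrite mulr_gt0 ?expR_gt0// exprn_gt0. Qed.

Let d4 : planar_grad i j (fun x : 'cV[R]_n => 4 * x j 0) (fun=> 0) (fun=> 4).
Proof.
have := planar_gradM (planar_grad_cst i j (4 : R)) (planar_grad_snd i j).
by move/planar_grad_eq; apply => x //; ring.
Qed.

Let dsin : planar_grad i j (fun x : 'cV[R]_n => sin (4 * x j 0)) (fun=> 0)
  (fun x => 4 * cos (4 * x j 0)).
Proof.
have := planar_grad_comp (h' := cos) d4 (fun x => is_derive_sin (4 * x j 0)).
by move/planar_grad_eq; apply=> x //=; ring.
Qed.

Let dcos : planar_grad i j (fun x : 'cV[R]_n => cos (4 * x j 0)) (fun=> 0)
  (fun x => - 4 * sin (4 * x j 0)).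
Proof.
have := planar_grad_comp (h' := fun y => - sin y) d4
  (fun x => is_derive_cos (4 * x j 0)).
by move/planar_grad_eq; apply=> x //=; ring.
Qed.

Lemma planar_grad_hard : planar_grad i j hard hard1 hard2.
Proof.
have := planar_gradD (planar_gradM (planar_gradD dcos
  (planar_grad_cst i j (-1))) (planar_grad_cst i j (1 / 32)))
  (planar_grad_sum s (planar_grad_bump delta kappa_gt0 i j)).
by move/planar_grad_eq; apply=> x; rewrite /hard /hard1 /hard2; field.
Qed.

Lemma planar_grad_hard1 : planar_grad i j hard1 hard11 hard12.
Proof. exact: planar_grad_sum (planar_grad_bump1 delta kappa_gt0 i j). Qed.

Lemma planar_grad_hard2 : planar_grad i j hard2 hard12 hard22.
Proof.
have := planar_gradD (planar_gradM dsin (planar_grad_cst i j (- 1 / 8)))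
  (planar_grad_sum s (planar_grad_bump2 delta kappa_gt0 i j)).
by move/planar_grad_eq; apply=> x; rewrite /hard2 /hard12 /hard22; field.
Qed.

Let sum_continuous (F : R -> 'cV[R]_n -> R) : (forall a, continuous (F a)) ->
  continuous (fun x => \sum_(a <- s) F a x).
Proof.
move=> cF; elim: s => [|a l IHl].
  rewrite (_ : (fun x => _) = cst 0); first exact: cst_continuous.
  by apply/funext => x; rewrite big_nil.
rewrite (_ : (fun x => _) = (fun x => F a x + \sum_(b <- l) F b x)).
  by move=> x; exact: (cvgD (cF a x) (IHl x)).
by apply/funext => x; rewrite big_cons.
Qed.

Lemma hard11_continuous : continuous hard11.
Proof.
by apply: sum_continuous => a; exact: (bump11_continuous kappa_gt0).
Qed.

Lemma hard12_continuous : continuous hard12.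
Proof.
by apply: sum_continuous => a; exact: (bump12_continuous kappa_gt0).
Qed.

Lemma hard22_continuous : continuous hard22.
Proof.
have c1 : continuous (fun x : 'cV[R]_n => - cos (4 * x j 0) / 2).
  rewrite (_ : (fun x => _) =
    (fun x : 'cV[R]_n => cos (4 * x j 0) * (- 1 / 2))).
    exact: planar_grad_continuous (planar_gradM dcos (planar_grad_cst _ _ _)).
  by apply/funext => x; field.
have c2 : continuous (fun x : 'cV[R]_n =>
    \sum_(a <- s) bump22 delta kappa (x i 0 - a) (x j 0)).
  by apply: sum_continuous => a; exact: (bump22_continuous kappa_gt0).
by move=> x; exact: (cvgD (c1 x) (c2 x)).
Qed.

Let bump_pos_far t u : rho <= `|t| -> bump_pos delta kappa t u = 0.
Proof.
move=> rt; apply: pospart_eq0; rewrite /bump_level subr_le0.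
have t2 : rho ^+ 2 <= t ^+ 2.
  by rewrite -(real_normK (num_real t)) lerXn2r// ?nnegrE ?ltW.
have -> : ln kappa = ln (rho ^+ 2) - delta^-1.
  by rewrite lnM ?posrE ?expR_gt0 ?exprn_gt0// expRK.
have : ln (rho ^+ 2) <= ln (bump_den kappa t u).
  rewrite ler_ln ?posrE ?exprn_gt0 ?bump_den_gt0// (le_trans t2)//.
  by rewrite /bump_den addrAC lerDr addr_ge0 ?sqr_ge0// ltW.
by rewrite /delta; lra.
Qed.

Let bump_far t u : rho <= `|t| -> bump delta kappa t u = 0.
Proof. by move=> rt; rewrite /bump bump_pos_far//; ring. Qed.
Let bump1_far t u : rho <= `|t| -> bump1 delta kappa t u = 0.
Proof. by move=> rt; rewrite /bump1 bump_pos_far//; ring. Qed.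
Let bump2_far t u : rho <= `|t| -> bump2 delta kappa t u = 0.
Proof. by move=> rt; rewrite /bump2 bump_pos_far//; ring. Qed.
Let bump11_far t u : rho <= `|t| -> bump11 delta kappa t u = 0.
Proof. by move=> rt; rewrite /bump11 bump_pos_far//; ring. Qed.
Let bump12_far t u : rho <= `|t| -> bump12 delta kappa t u = 0.
Proof. by move=> rt; rewrite /bump12 bump_pos_far//; ring. Qed.
Let bump22_far t u : rho <= `|t| -> bump22 delta kappa t u = 0.
Proof. by move=> rt; rewrite /bump22 bump_pos_far//; ring. Qed.

Let delta_ge0 : 0 <= delta. Proof. by rewrite /delta; lra. Qed.
Let delta_le : delta <= 1 / 4. Proof. by rewrite /delta; lra. Qed.

(** The Hessian of the wave, plus p times that of the saddle, up to small
    errors: p is the value of the cutoff of the only center near x, or 0. *)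
Lemma hard_hess_near (x : 'cV[R]_n) : exists p e11 e12 e22 : R,
  [/\ 0 <= p <= 1, [/\ `|e11| <= 12 / 1000, `|e12| <= 12 / 1000
    & `|e22| <= 12 / 1000] &
    [/\ hard11 x = - (p / 2) + e11, hard12 x = e12 &
    hard22 x = - cos (4 * x j 0) / 2 + p / 2 + e22]].
Proof.
have [H|[a sa H]] := sum_locally_single (x i 0) sep.
  exists 0, 0, 0, 0; rewrite /hard11 /hard12 /hard22.
  rewrite (H (fun t => bump11 delta kappa t (x j 0)) (bump11_far ^~ _)).
  rewrite (H (fun t => bump12 delta kappa t (x j 0)) (bump12_far ^~ _)).
  rewrite (H (fun t => bump22 delta kappa t (x j 0)) (bump22_far ^~ _)).
  split; first by rewrite lexx ler01.
    by rewrite normr0; split; lra.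
  by rewrite mul0r oppr0 !addr0.
set t := x i 0 - a; set u := x j 0.
exists (bump_pos delta kappa t u ^+ 3),
  (bump11 delta kappa t u + bump_pos delta kappa t u ^+ 3 / 2),
  (bump12 delta kappa t u),
  (bump22 delta kappa t u - bump_pos delta kappa t u ^+ 3 / 2).
rewrite /hard11 /hard12 /hard22.
rewrite (H (fun t => bump11 delta kappa t (x j 0)) (bump11_far ^~ _)).
rewrite (H (fun t => bump12 delta kappa t (x j 0)) (bump12_far ^~ _)).
rewrite (H (fun t => bump22 delta kappa t (x j 0)) (bump22_far ^~ _)).
rewrite -/t -/u; split.
- rewrite exprn_ge0 ?pospart_ge0// exprn_ile1 ?pospart_ge0//.
  exact: bump_pos_le1.
- have e : 12 / 1000 = 12 * delta by rewrite /delta; field.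
  by rewrite e bump11_bound// bump12_bound// bump22_bound.
- by split; ring.
Qed.

Lemma hard_hess_bound (x : 'cV[R]_n) : [/\ `|hard11 x| <= 2,
  `|hard12 x| <= 2 & `|hard22 x| <= 2].
Proof.
have [p [e11 [e12 [e22 [/andP[p0 p1] [h1 h2 h3] [-> -> ->]]]]]] :=
  hard_hess_near x.
have := cos_max (4 * x j 0).
move: h1 h2 h3; rewrite !ler_norml.
by move=> /andP[? ?] /andP[? ?] /andP[? ?] /andP[? ?]; split; apply/andP; lra.
Qed.

(** The two contributions of the saddle cancel, and cos (4 s) >= 1/2 for
    |s| <= 1/8. *)
Lemma hard_curved (x : 'cV[R]_n) : `|x j 0| <= 1 / 8 ->
  hard11 x + 2 * hard12 x + hard22 x <= - (2 / 10).
Proof.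
move=> xj.
have [p [e11 [e12 [e22 [/andP[p0 p1] [h1 h2 h3] [-> -> ->]]]]]] :=
  hard_hess_near x.
have := cos_ge1B (4 * x j 0).
rewrite normrM ger0_norm//.
move: h1 h2 h3; rewrite !ler_norml => /andP[? ?] /andP[? ?] /andP[? ?].
by lra.
Qed.

(** The wave is at least - 1/16, and the saddle at least - rho^2 / 4 on the
    support of its cutoff. *)
Lemma hard_ge (x : 'cV[R]_n) : - (17 / 256) <= hard x.
Proof.
have := cos_geN1 (4 * x j 0).
suff : - (1 / 256) <= \sum_(a <- s) bump delta kappa (x i 0 - a) (x j 0).
  by rewrite /hard; lra.
have [H|[a sa H]] := sum_locally_single (x i 0) sep;
  rewrite (H (fun t => bump delta kappa t (x j 0)) (bump_far ^~ _)).
  by lra.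
have [far|near_a] := lerP rho `|x i 0 - a|; first by rewrite bump_far//; lra.
apply: le_trans (bump_ge kappa_gt0 delta_ge0 _ _).
have : (x i 0 - a) ^+ 2 <= (1 / 8) ^+ 2.
  rewrite -(real_normK (num_real (x i 0 - a))) lerXn2r// ?nnegrE//.
  by rewrite (le_trans (ltW near_a)).
by rewrite expr_div_n; lra.
Qed.

(** At a center the cutoff is 1 and the saddle is critical with value 0, whence
    the answers that do not reveal j. *)
Lemma hard_center (x : 'cV[R]_n) : x i 0 \in s -> x j 0 = 0 ->
  [/\ hard x = 0, hard1 x = 0, hard2 x = 0 &
  [/\ hard11 x = - (1 / 2), hard12 x = 0 & hard22 x = 0]].
Proof.
move=> xs xj.
have E (K : R -> R) : (forall d, rho <= `|d| -> K d = 0) ->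
    \sum_(a <- s) K (x i 0 - a) = K 0.
  move=> K0; case: sep => us sp.
  rewrite (bigD1_seq (x i 0))//= subrr big_seq_cond big1 ?addr0//.
  move=> b /andP[sb bx]; apply: K0; rewrite eq_sym in bx.
  by have := sp _ _ xs sb bx; have := ltW rho_gt0; lra.
have p1 : bump_pos delta kappa 0 0 = 1.
  rewrite /bump_pos /bump_level /bump_den expr0n /= !addr0 subrr mulr0 subr0.
  by rewrite pospart_id.
rewrite /hard /hard1 /hard2 /hard11 /hard12 /hard22 xj mulr0 cos0 sin0.
rewrite (E (fun t => bump delta kappa t 0) (bump_far ^~ _)).
rewrite (E (fun t => bump1 delta kappa t 0) (bump1_far ^~ _)).
rewrite (E (fun t => bump2 delta kappa t 0) (bump2_far ^~ _)).
rewrite (E (fun t => bump11 delta kappa t 0) (bump11_far ^~ _)).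
rewrite (E (fun t => bump12 delta kappa t 0) (bump12_far ^~ _)).
rewrite (E (fun t => bump22 delta kappa t 0) (bump22_far ^~ _)).
rewrite /bump /bump1 /bump2 /bump11 /bump12 /bump22 p1 /saddle.
move: (bump_den kappa 0 0)^-1 => e.
by split; [field..|split; field].
Qed.

End HardFunction.

(** * Iterates under a constant answer *)

Section ConstantAnswers.
Context {R : realType} {n m : nat} (A : @algorithm R n m).
Context (o : R * 'cV[R]_n * @symmx R n).

(** The trajectory when every query is answered by o: it is determined by the
    algorithm alone. *)
Fixpoint blind_trajectory (k : nat) : k.+1.-tuple 'cV[R]_n :=
  match k with
  | 0 => [tuple start A]
  | k'.+1 =>
      let h := blind_trajectory k' in
      let next := match idP : reflect _ (k' < m)%N with
        | ReflectT lt_k'm =>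
            @step R n m A (Ordinal lt_k'm) (map_tuple (fun x => (x, o)) h)
        | ReflectF _ => 0
        end in
      rcons_tuple h next
  end.

Lemma trajectory_blind (f : 'cV[R]_n -> R) (k : nat) :
  (forall l, (l < k)%N -> {in blind_trajectory l, forall x, oracle f x = o}) ->
  trajectory A f k = blind_trajectory k.
Proof.
elim: k => // k IHk ok /=.
rewrite IHk => [|l lk]; last exact/ok/ltnW.
have -> // : map_tuple (fun x => (x, oracle f x)) (blind_trajectory k)
  = map_tuple (fun x => (x, o)) (blind_trajectory k).
by apply/val_inj/eq_in_map => x xk /=; rewrite (ok k).
Qed.

Lemma mem_blind_trajectoryS (k : nat) x : x \in blind_trajectory k.+1 ->
  x = tnth (blind_trajectory k.+1) ord_max \/ x \in blind_trajectory k.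
Proof.
rewrite [tnth _ _](tnth_nth x) /= nth_rcons size_tuple ltnn eqxx.
by rewrite mem_rcons in_cons => /predU1P.
Qed.

Lemma sub_blind_trajectory (k l : nat) : (k <= l)%N ->
  {subset blind_trajectory k <= blind_trajectory l}.
Proof.
move=> /subnKC <-; elim: (l - k)%N => [|d IHd] x xk; first by rewrite addn0.
by rewrite addnS /= mem_rcons in_cons IHd ?orbT.
Qed.

End ConstantAnswers.

Section ZeroRespectingOnAxis.
Context {R : realType} {n m : nat} (A : @algorithm R n m).
Context (o : R * 'cV[R]_n * @symmx R n) (i : 'I_n) (f : 'cV[R]_n -> R).

Let on_axis (x : 'cV[R]_n) := supp x \subset [set i]%SET.

Hypotheses (zrA : zero_respecting A) (f_C2 : forall x, C2_near f x).
Hypothesis f_axis : {in blind_trajectory A o m, forall x, on_axis x ->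
  [/\ oracle f x = o, grad f x = 0
    & nonzero_rows (hess f x) \subset [set i]%SET]}.

(** The hypothesis gives the answers of f only at points already known to lie on
    the axis.  By strong induction, the algorithm applied to f follows the blind
    trajectory up to step k, and being zero-respecting for f it then keeps step
    k on the axis. *)
Lemma blind_trajectory_on_axis (k : nat) : (k <= m)%N ->
  {in blind_trajectory A o k, forall x, on_axis x}.
Proof.
move=> km.
have last_on_axis (l : nat) : (l <= m)%N ->
    (forall l', (l' < l)%N ->
      {in blind_trajectory A o l', forall x, on_axis x}) ->
    on_axis (tnth (blind_trajectory A o l) ord_max).
  move=> lm axis.
  have ok l' : (l' < l)%N -> {in blind_trajectory A o l', forall x,
      [/\ oracle f x = o, grad f x = 0
        & nonzero_rows (hess f x) \subset [set i]%SET]}.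
    move=> l'l x xl'; apply: f_axis; last exact: axis xl'.
    by apply: sub_blind_trajectory xl'; exact: leq_trans (ltnW l'l) lm.
  have trajE l' : (l' <= l)%N -> trajectory A f l' = blind_trajectory A o l'.
    move=> l'l; apply: trajectory_blind => l'' l''l' x xl''.
    by have [] := ok l'' (leq_trans l''l' l'l) x xl''.
  have iterE l' : (l' <= l)%N ->
      iterate A f l' = tnth (blind_trajectory A o l') ord_max.
    by move=> l'l; rewrite /iterate trajE.
  rewrite -iterE// /on_axis.
  have fC2 p : (p < m)%N -> C2_near f (iterate A f p) by move=> _; exact: f_C2.
  apply: (fintype.subset_trans (zrA fC2 lm)).
  have okE (l' : 'I_l) : [/\ oracle f (iterate A f l') = o,
      grad f (iterate A f l') = 0
      & nonzero_rows (hess f (iterate A f l')) \subset [set i]%SET].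
    apply: (ok l' (ltn_ord l')).
    by rewrite iterE ?(ltnW (ltn_ord _))// mem_tnth.
  rewrite finset.subUset; apply/andP; split; apply/finset.bigcupsP => l' _;
    have [_ g0 h0] := okE l' => //.
  by rewrite g0; apply/fintype.subsetP => q; rewrite inE mxE eqxx.
have [b kb] := ubnP k; elim: b => // b IHb in k km kb *.
case: k => [|k] in km kb *.
  move=> x; rewrite inE => /eqP ->.
  by apply: (last_on_axis 0%N).
move=> x /mem_blind_trajectoryS[->|xk]; last first.
  by apply: IHb xk => //; exact: ltnW.
apply: last_on_axis => // l' l'k; apply: IHb.
  by rewrite (leq_trans _ km)// ltnW.
by rewrite -ltnS (leq_trans _ kb).
Qed.

Lemma iterate_on_axis (k : nat) : (k <= m)%N ->
  iterate A f k \in blind_trajectory A o k /\ on_axis (iterate A f k).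
Proof.
move=> km.
have E : trajectory A f k = blind_trajectory A o k.
  apply: trajectory_blind => l lk x xl.
  have lm := leq_trans (ltnW lk) km.
  have [] // := f_axis (sub_blind_trajectory lm xl).
  exact: blind_trajectory_on_axis lm _ xl.
by rewrite /iterate E mem_tnth; split => //;
  apply: (blind_trajectory_on_axis km); rewrite mem_tnth.
Qed.

End ZeroRespectingOnAxis.

(** * Curvature of functions with continuous Hessian *)

Section Hulls.
Context {R : realType}.

Lemma convex_hull_le (E : lmodType R) (S : set E) (l : E -> R) (c : R) :
  (forall (a b : R) x y, l (a *: x + b *: y) = a * l x + b * l y) ->
  (forall x, S x -> l x <= c) -> forall x, convex_hull S x -> l x <= c.
Proof.
move=> lin Sc; apply: smallest_sub => // x y k.
rewrite !inE /= => xc yc.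
have k0 : 0 <= k%:num by [].
have k1 : 0 <= 1 - k%:num by rewrite subr_ge0.
suff : k%:num * l x + (1 - k%:num) * l y <= c by rewrite -lin.
have := ler_wpM2l k0 xc; have := ler_wpM2l k1 yc; lra.
Qed.

Lemma dotZD n (a b : R) (x y w : 'cV[R]_n) :
  dot (a *: x + b *: y) w = a * dot x w + b * dot y w.
Proof.
rewrite /dot !mulr_sumr -big_split; apply: eq_bigr => k _ /=.
by rewrite !mxE; ring.
Qed.

(** By continuity of the Hessian, the only possible generator of the Clarke
    Hessian at y is the Hessian at y. *)
Lemma clarke_hessian_quadratic_le n (f : 'cV[R]_n -> R) (y w : 'cV[R]_n)
    (c : R) : continuous (hess f) -> dot (hess f y *m w) w <= c ->
  forall A, clarke_hessian f y A -> dot (A *m w) w <= c.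
Proof.
move=> hc yc; apply: (convex_hull_le (l := fun A : 'M[R]_n => dot (A *m w) w)).
  by move=> a b A B; rewrite mulmxDl -!scalemxAl dotZD.
move=> A [u [_ uy uA]].
have hA : (fun q => hess f (u q)) @ \oo --> hess f y.
  by apply: (@cvg_comp _ _ _ u (hess f) _ (nbhs y)) => //; exact: hc.
by have -> : A = hess f y by apply: cvg_unique uA hA.
Qed.

Lemma curvature_le n (f : 'cV[R]_n -> R) (delta c : R) (x w : 'cV[R]_n) :
  continuous (hess f) -> l2norm w = 1 ->
  (forall y, l2norm (y - x) <= delta -> dot (hess f y *m w) w <= c) ->
  (curvature delta f x <= c%:E)%E.
Proof.
move=> hc w1 yc.
apply: (@le_trans _ _ (ereal_sup [set (dot z w)%:E | z in
  convex_hull (\bigcup_(y in eball x delta) clarke_hessian_vec f y w)])).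
  by apply: ereal_inf_lbound; exists w.
apply: ge_ereal_sup => _ [z zH <-]; rewrite lee_fin.
apply: (convex_hull_le (l := fun z => dot z w)) zH.
  by move=> a b z1 z2; exact: dotZD.
by move=> _ [y yx [A AH <-]]; apply: clarke_hessian_quadratic_le AH => //;
  exact: yc.
Qed.

End Hulls.

(** * A resisting function for every zero-respecting algorithm *)

Section ResistingFunction.
Context {R : realType} {n m : nat} (A : @algorithm R n m) (i j : 'I_n).
Hypotheses (neq_ij : i != j) (zrA : zero_respecting A).

Let answer : R * 'cV[R]_n * @symmx R n :=
  (0, 0, insubd (@symmx0 R n) (- (1 / 2) *: delta_mx i i)).

Let centers : seq R :=
  undup [seq x i 0 | x : 'cV[R]_n <- blind_trajectory A answer m].

(** The centers are the coordinates of the blind iterates, so that the blind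
    answers are the true ones. *)
Lemma exists_resisting : exists f : 'cV[R]_n -> R,
  function_class (4 + 86 / 1000) (17 / 256) A f /\
  forall k, (k <= m)%N ->
    (curvature (1 / 8) f (iterate A f k) <= (- (1 / 10))%:E)%E.
Proof.
have [|rho /andP[rho0 rho8] sep] :=
  @exists_separated R centers (1 / 8) _ (undup_uniq _); first by lra.
pose f := hard i j rho centers.
have df : planar_grad i j f _ _ := planar_grad_hard i j centers rho0.
have df1 := planar_grad_hard1 i j centers rho0.
have df2 := planar_grad_hard2 i j centers rho0.
have c11 : continuous (hard11 i j rho centers).
  by move=> x; exact: (hard11_continuous rho0).
have c12 : continuous (hard12 i j rho centers).
  by move=> x; exact: (hard12_continuous rho0).
have c22 : continuous (hard22 i j rho centers).
  by move=> x; exact: (hard22_continuous rho0).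
have hess_cont : continuous (hess f).
  exact: (planar_hess_continuous df df1 df2).
have f_C2 x : C2_near f x by exact: (planar_C2_near df df1 df2).
have axis_coord (x : 'cV[R]_n) k : supp x \subset [set i]%SET -> k != i ->
    x k 0 = 0.
  move=> /fintype.subsetP xi ki; apply/eqP/negPn/negP => xk.
  by have := xi k; rewrite !inE xk (negPf ki) => /(_ isT).
have center (x : 'cV[R]_n) : x \in blind_trajectory A answer m ->
    supp x \subset [set i]%SET ->
    [/\ f x = 0, grad f x = 0 & hess f x = - (1 / 2) *: delta_mx i i].
  move=> xT xi.
  have xs : x i 0 \in centers by rewrite mem_undup; apply/mapP; exists x.
  have [|f0 g1 g2 [h11 h12 h22]] :=
    @hard_center _ _ i j rho centers rho0 sep x xs.
    by apply: axis_coord => //; rewrite eq_sym.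
  rewrite (planar_gradE df) (planar_hessE df df1 df2) g1 g2 h11 h12 h22.
  by rewrite !scale0r !addr0.
have f_axis : {in blind_trajectory A answer m, forall x,
    supp x \subset [set i]%SET -> [/\ oracle f x = answer, grad f x = 0
      & nonzero_rows (hess f x) \subset [set i]%SET]}.
  move=> x xT xi; have [f0 g0 h0] := center x xT xi.
  rewrite /oracle f0 g0 h0; split => //.
  apply/fintype.subsetP => k; rewrite !inE; apply: contra_neqT => ki.
  by apply/rowP => l; rewrite !mxE (negPf ki) mulr0.
have iterP k : (k <= m)%N -> iterate A f k \in blind_trajectory A answer m /\
    supp (iterate A f k) \subset [set i]%SET.
  move=> km; have [T1 T2] := iterate_on_axis zrA f_C2 f_axis km.
  by split=> //; exact: sub_blind_trajectory T1.
exists f; split.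
- split.
  + exact: (planar_C1 df df1 df2).
  + move=> x y; have B := @hard_hess_bound _ _ i j rho centers rho0 sep.
    have := planar_grad_lipschitz neq_ij df df1 df2
      (fun x => let: And3 b _ _ := B x in b)
      (fun x => let: And3 _ b _ := B x in b)
      (fun x => let: And3 _ _ b := B x in b) x y.
    have := sqrtr_ge0 (dot (x - y) (x - y)); rewrite -/(l2norm (x - y)).
    by lra.
  + have [x0T x0i] := iterP 0%N (leq0n m).
    have [-> _ _] := center _ x0T x0i.
    rewrite add0e leeNl; apply: le_ereal_inf_tmp => _ [x _ <-].
    rewrite -EFinN lee_fin; exact: hard_ge.
  + by move=> k _; exact: f_C2.
move=> k km; have [_ ki] := iterP k km.
pose c : R := Num.sqrt (1 / 2).
have c2 : c ^+ 2 = 1 / 2 by rewrite sqr_sqrtr//; lra.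
apply: (@curvature_le _ _ _ _ _ _ (c *: (delta_mx i 0 + delta_mx j 0))) => //.
- rewrite /l2norm /dot (bigD1 i)//= (bigD1 j) 1?eq_sym//= big1 ?addr0.
    rewrite !mxE !eqxx (negPf neq_ij) eq_sym (negPf neq_ij) /= addr0 add0r.
    by rewrite !mulr1 -!expr2 c2 (_ : 1 / 2 + 1 / 2 = 1) ?sqrtr1//; field.
  by move=> l /andP[/negPf li /negPf lj]; rewrite !mxE li lj addr0 !mulr0.
move=> y yk; rewrite (planar_dot_hess neq_ij df df1 df2) c2.
have yj : `|y j 0| <= 1 / 8.
  have xj : iterate A f k j 0 = 0 by apply: axis_coord => //; rewrite eq_sym.
  apply: le_trans yk; rewrite /l2norm -sqrtr_sqr; apply: ler_wsqrtr.
  apply: le_trans (dot_ge_pair neq_ij _); rewrite !mxE xj subr0 lerDr.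
  exact: sqr_ge0.
have := hard_curved i rho0 sep yj; lra.
Qed.

End ResistingFunction.

Theorem theorem3p1 (R : realType) :
  (ereal_sup [set v : \bar R |
     exists (m n : nat) (A : @algorithm R n m),
       [/\ (1 <= m)%N, (2 <= n)%N, zero_respecting A
         & v = ereal_inf
             [set \big[maxe/-oo]_(k < m.+1)
                    curvature (1 / 8) f (iterate A f k)
               | f in function_class (4 + 86 / 1000) (17 / 256) A]]]
   <= (- ((9 + 2714 / 10 ^+ 4) / 10 ^+ 3))%:E)%E.
Proof.
apply: ge_ereal_sup => _ [m [n [A [_ n2 zrA ->]]]].
have neq01 : Ordinal (ltnW n2) != Ordinal n2 by [].
have [f [fA curv]] := exists_resisting neq01 zrA.
apply: (@le_trans _ _ (- (1 / 10))%:E); last by rewrite lee_fin; lra.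
apply: (@le_trans _ _ (\big[maxe/-oo%E]_(k < m.+1)
  curvature (1 / 8) f (iterate A f k))%E).
  by apply: ereal_inf_lbound; exists f.
apply: (big_ind (fun v : \bar R => v <= (- (1 / 10))%:E)%E).
- exact: leNye.
- by move=> u v u1 v1; rewrite ge_max u1.
- by move=> k _; apply: curv; rewrite -ltnS.
Qed.
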